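(* Let $(E,\le_E)$ be a non-empty finite totally ordered set, let $I = [p,q]$ be an interval in $E$, let $X$ be a non-empty set and let $\bullet$ be a binary operation on $X$. Suppose that $\bullet$ is associative. Then $$\bullet_{\mathbf{R}}(s \mapsto x_s) = \bullet(s \mapsto x_s)$$ for each $I$-tuple $(s \mapsto x_s)$ with values in $X$ and each $I$-reduction $\mathbf{R}$.
   Context: Let $(E,\le_E)$ be a non-empty finite totally ordered set with maximum element $z$, and let $f : E \to E$ be the mapping with $f(e)$ the least element of $\{e' \in E : e' >_E e\}$ if $e \ne z$, and $f(z) = z$. For $r \le_E s$ put $[r,s] = \{e \in E : r \le_E e \le_E s\}$; sets of this form are called intervals. Also $[r,s) = \{e \in E : r \le_E e <_E s\}$. If $I$ is an interval, an $I$-tuple with values in $X$ is a mapping $s \mapsto x_s$ from $I$ to $X$. Standard product: for an interval $I=[p,q]$ and an $I$-tuple $s \mapsto x_s$ there is a unique $I$-tuple $s \mapsto \pi_s$ with $\pi_p = x_p$ and $\pi_{f(s)} = \pi_s \bullet x_{f(s)}$ for all $s \in [p,q)$; put $\bullet(s \mapsto x_s) = \pi_q$. Partitions: in what follows a partition of $I$ means a set $\mathcal{Q}$ of intervals contained in $I$ such that each $s \in I$ lies in exactly one element of $\mathcal{Q}$. Let $\mathcal{Q}_0$ be the partition of $I$ consisting of the singletons $[r,r]$, $r \in I$, and $\mathcal{Q}_T = \{I\}$. If $J = [r,s]$ and $K = [u,v]$ are (distinct) elements of a partition $\mathcal{Q}$ then $(J,K)$ is an adjacent pair if $f(s) = u$;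 in this case $J \cup K = [r,v]$, and $\mathcal{Q}(J,K)$ denotes the partition $(\mathcal{Q} \setminus \{J,K\}) \cup \{J \cup K\}$. A partition of the form $\mathcal{Q}(J,K)$ for some adjacent pair $(J,K)$ in $\mathcal{Q}$ is called a reduction of $\mathcal{Q}$. $I$-reductions: an $I$-reduction is a triple $\mathbf{R} = (\mathbf{Q},\Phi,\mathcal{Q}_0)$, where $\mathbf{Q}$ is a set of partitions of $I$ containing $\mathcal{Q}_0$ and $\mathcal{Q}_T$, and $\Phi : \mathbf{Q} \to \mathbf{Q}$ is a mapping with $\Phi(\mathcal{Q}_T) = \mathcal{Q}_T$, such that $\Phi(\mathcal{Q})$ is a reduction of $\mathcal{Q}$ for each $\mathcal{Q} \in \mathbf{Q} \setminus \{\mathcal{Q}_T\}$, and such that $\mathbf{R}$ is minimal, i.e. the only subset $\mathbf{Q}'$ of $\mathbf{Q}$ with $\mathcal{Q}_0 \in \mathbf{Q}'$ and $\Phi(\mathbf{Q}') \subset \mathbf{Q}'$ is $\mathbf{Q}$ itself. Product along $\mathbf{R}$: given an $I$-tuple $s \mapsto x_s$ and an $I$-reduction $\mathbf{R}$, there is a unique family of mappings $\omega_{\mathcal{Q}} : \mathcal{Q} \to X$, $\mathcal{Q} \in \mathbf{Q}$, such that $\omega_{\mathcal{Q}_0}([s,s]) = x_s$ for each $s \in I$ and such that, if $\mathcal{Q} \in \mathbf{Q} \setminus \{\mathcal{Q}_T\}$ with $\Phi(\mathcal{Q}) = \mathcal{Q}(J,K)$ for an adjacent pair $(J,K)$, then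 $\omega_{\Phi(\mathcal{Q})}(M) = \omega_{\mathcal{Q}}(M)$ for $M \in \Phi(\mathcal{Q})$ with $M \ne J \cup K$, and $\omega_{\Phi(\mathcal{Q})}(J \cup K) = \omega_{\mathcal{Q}}(J) \bullet \omega_{\mathcal{Q}}(K)$. Put $\bullet_{\mathbf{R}}(s \mapsto x_s) = \omega_{\mathcal{Q}_T}(I)$. *)

(* Defs.v *)
From HB Require Import structures.
From mathcomp Require Import all_boot all_order.

Set Implicit Arguments.
Unset Strict Implicit.
Unset Printing Implicit Defensive.

Import Order.Theory.
Local Open Scope order_scope.

Section Intervals.
Context {d : Order.disp_t} {E : finTBOrderType d}.
Implicit Types (r s e p : E) (I J K M : {set E}) (Q : {set {set E}}).

Definition next e : E :=
  if e == \top then \top else [arg min_(e' < \top | e < e') e'].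

Definition itv r s : {set E} := [set e | r <= e <= s].

Definition is_itv J : bool :=
  [exists r, [exists s, (r <= s) && (J == itv r s)]].

Definition itv_partition I Q : Prop :=
  (forall J, J \in Q -> is_itv J /\ J \subset I) /\
  (forall s, s \in I -> exists! J, J \in Q /\ s \in J).

Definition singletons I : {set {set E}} := [set itv r r | r in I].

(* [J != K] is not redundant: [next \top = \top], so without it [set \top]
   would be adjacent to itself. *)
Definition adjacent Q J K : bool :=
  [&& J \in Q, K \in Q, J != K &
    [exists r, [exists s, [exists u, [exists v,
      [&& r <= s, u <= v, J == itv r s, K == itv u v & next s == u]]]]]].

Definition merge Q J K : {set {set E}} := (J :|: K) |: (Q :\: [set J; K]).

Definition is_reduction Q Q' : Prop :=
  exists J K, adjacent Q J K /\ Q' = merge Q J K.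

Lemma next_lt e : e != \top -> e < next e.
Proof.
rewrite /next => et; rewrite (negbTE et).
by case: arg_minP => //; rewrite lt_neqAle et lex1.
Qed.

Lemma next_min e e' : e < e' -> next e <= e'.
Proof.
move=> lt_e; rewrite /next; case: eqP => [et|/eqP et].
  by move: lt_e; rewrite et ltNge lex1.
by case: arg_minP => [|i _]; [rewrite lt_neqAle et lex1 | apply].
Qed.

Lemma next_top : next \top = \top.
Proof. by rewrite /next eqxx. Qed.

Lemma le_next e : e <= next e.
Proof.
have [->|et] := eqVneq e \top; first by rewrite next_top.
exact/ltW/next_lt.
Qed.

Lemma next_pred p e : p < e -> exists t, [/\ p <= t, t < e & next t = e].
Proof.
move=> lt_pe.
case: (@arg_maxP _ _ _ p (fun t => t < e) id lt_pe) => t lt_te tmax.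
exists t; split=> //; first exact: tmax.
apply/le_anti/andP; split; first exact: next_min.
rewrite leNgt; apply/negP => h; have: next t <= t := tmax _ h.
rewrite leNgt => /negP; apply.
by apply: next_lt; apply: contraTN lt_te => /eqP ->; rewrite -leNgt lex1.
Qed.

Lemma mem_itv r s e : (e \in itv r s) = (r <= e <= s).
Proof. by rewrite inE. Qed.

Lemma itv_l r s : r <= s -> r \in itv r s.
Proof. by rewrite mem_itv lexx. Qed.

Lemma itv_r r s : r <= s -> s \in itv r s.
Proof. by rewrite mem_itv lexx => ->. Qed.

Lemma is_itv_neq0 J : is_itv J -> exists e, e \in J.
Proof.
by case/existsP=> r /existsP[s /andP[rs /eqP->]]; exists r; apply: itv_l.
Qed.

Lemma block_eq I Q J K e : itv_partition I Q ->
  J \in Q -> K \in Q -> e \in J -> e \in K -> J = K.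
Proof.
move=> [QI Qu] JQ KQ eJ eK; have [_ /subsetP JI] := QI _ JQ.
have [L [_ Lu]] := Qu _ (JI _ eJ).
by rewrite -(Lu J) // -(Lu K).
Qed.

Lemma block_neq0 I Q J : itv_partition I Q -> J \in Q -> exists e, e \in J.
Proof. by move=> [QI _] /QI[/is_itv_neq0]. Qed.

Lemma adjacent_le Q J K a b : adjacent Q J K -> a \in J -> b \in K -> a <= b.
Proof.
case/and4P=> _ _ _ /existsP[r /existsP[s /existsP[u /existsP[v]]]].
case/and5P=> _ _ /eqP-> /eqP-> /eqP<-; rewrite !mem_itv.
move=> /andP[_ le_as] /andP[le_sb _].
exact: le_trans le_as (le_trans (le_next s) le_sb).
Qed.

Lemma adjacent_asym I Q J K : itv_partition I Q ->
  adjacent Q J K -> ~~ adjacent Q K J.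
Proof.
move=> Qp JK; apply/negP => KJ; have /and4P[JQ KQ /eqP nJK _] := JK; apply: nJK.
have [a aJ] := block_neq0 Qp JQ; have [b bK] := block_neq0 Qp KQ.
have ab : a = b.
  by apply/le_anti; rewrite (adjacent_le JK) // (adjacent_le KJ).
by apply: (block_eq Qp JQ KQ aJ); rewrite ab.
Qed.

Lemma adjacent_union I Q J K L : itv_partition I Q -> adjacent Q J K ->
  L \in Q -> (exists e, e \in L /\ e \in J :|: K) -> L = J \/ L = K.
Proof.
move=> Qp /and4P[JQ KQ _ _] LQ [e [eL]]; rewrite inE.
by case/orP=> eJ; [left|right]; apply: (block_eq Qp _ _ eL eJ).
Qed.

Lemma union_notin I Q J K : itv_partition I Q -> adjacent Q J K ->
  J :|: K \notin Q.
Proof.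
move=> Qp /and4P[JQ KQ /eqP JK _]; apply/negP => UQ; apply: JK.
have [a aJ] := block_neq0 Qp JQ; have [b bK] := block_neq0 Qp KQ.
have <- : J :|: K = J by apply: (block_eq Qp UQ JQ _ aJ); rewrite inE aJ.
by apply: (block_eq Qp UQ KQ _ bK); rewrite inE bK orbT.
Qed.

Lemma adjacent_inj I Q J K J' K' : itv_partition I Q ->
  adjacent Q J K -> adjacent Q J' K' -> J :|: K = J' :|: K' ->
  J = J' /\ K = K'.
Proof.
move=> Qp A A' U; have /and4P[JQ KQ /eqP JK _] := A.
have [a aJ] := block_neq0 Qp JQ; have [b bK] := block_neq0 Qp KQ.
have HJ : J = J' \/ J = K'.
  by apply: adjacent_union Qp A' JQ _; exists a; rewrite -U inE aJ.
have HK : K = J' \/ K = K'.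
  by apply: adjacent_union Qp A' KQ _; exists b; rewrite -U inE bK orbT.
case: HJ HK => eJ [] eK //; try by case: JK; rewrite eJ eK.
by move: (adjacent_asym Qp A); rewrite eJ eK A'.
Qed.

Lemma card_merge I Q J K : itv_partition I Q -> adjacent Q J K ->
  #|merge Q J K|.+1 = #|Q|.
Proof.
move=> Qp A; have /and4P[JQ KQ JK _] := A.
rewrite cardsU1 inE (negbTE (union_notin Qp A)) andbF /=.
rewrite -[RHS](cardsID [set J; K] Q) (setIidPr _); last first.
  by apply/subsetP => L; rewrite !inE => /orP[]/eqP->.
by rewrite cards2 JK.
Qed.

End Intervals.

Definition ituple d (E : finTBOrderType d) (p q : E) (X : Type) : Type :=
  {s : E | s \in itv p q} -> X.

Section StandardProduct.
Context {d : Order.disp_t} {E : finTBOrderType d} (p q : E) (X : Type).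
Variables (op : X -> X -> X) (x : ituple p q X).

Definition is_std_tuple (pi : ituple p q X) : Prop :=
  (forall s, sval s = p -> pi s = x s) /\
  (forall s t, sval s < q -> sval t = next (sval s) ->
     pi t = op (pi s) (x t)).

Let rank (e : E) : nat := #|[set e' | p <= e' < e]|.

Let rank_next e : p <= e -> e != \top -> rank (next e) = (rank e).+1.
Proof.
move=> pe et; rewrite /rank.
have -> : [set e' | p <= e' < next e] = e |: [set e' | p <= e' < e].
  apply/setP => t; rewrite !inE; have [->|te] := eqVneq t e.
    by rewrite pe next_lt.
  congr (_ && _); apply/idP/idP => h; last exact: lt_trans h (next_lt et).
  by rewrite lt_neqAle te leNgt; apply: contraL h => /next_min; rewrite -leNgt.
by rewrite cardsU1 inE ltxx andbF.
Qed.

Let lt_ntop (e e' : E) : e < e' -> e != \top.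
Proof. by apply: contraTN => /eqP->; rewrite -leNgt lex1. Qed.

Let iter_rank e : p <= e -> iter (rank e) next p = e.
Proof.
have [n] := ubnP (rank e); elim: n e => // n IHn e; rewrite ltnS => ren.
rewrite le_eqVlt => /predU1P[<-|/next_pred[t [pt te nt]]].
  rewrite /rank (_ : [set _ | _] = set0) ?cards0 //.
  by apply/setP => e'; rewrite !inE; case: leP.
have rE : rank e = (rank t).+1 by rewrite -nt rank_next // (lt_ntop te).
by rewrite rE /= IHn // -rE.
Qed.

Lemma std_tuple_exists : p <= q -> {y : ituple p q X | is_std_tuple y}.
Proof.
move=> pq; pose p0 : {s | s \in itv p q} := exist _ p (itv_l pq).
pose xx e := if insub e is Some s then x s else x p0.
have xxE s : xx (sval s) = x s by rewrite /xx valK.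
pose w n := iteri n (fun k y => op y (xx (iter k.+1 next p))) (x p0).
exists (fun s => w (rank (sval s))); split=> [s sp|s t sq ts].
  rewrite (_ : s = p0); last exact: val_inj.
  rewrite (_ : rank _ = 0%N) //=; apply: eq_card0 => e'.
  by rewrite !inE; case: leP.
have ps : p <= sval s by have := valP s; rewrite mem_itv => /andP[].
rewrite ts rank_next ?(lt_ntop sq) // -xxE; congr (op _ (xx _)).
by rewrite iterS iter_rank.
Qed.

Lemma std_tuple_unique pi pi' :
  is_std_tuple pi -> is_std_tuple pi' -> forall s, pi s = pi' s.
Proof.
move=> [h0 h1] [h0' h1'] s.
have [n] := ubnP (rank (sval s)); elim: n s => // n IHn s; rewrite ltnS => rsn.
have := valP s; rewrite mem_itv => /andP[].
rewrite le_eqVlt => /predU1P[sp|/next_pred[t [pt ts nt]] sq].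
  by rewrite h0 ?h0'.
have tI : t \in itv p q by rewrite mem_itv pt (le_trans (ltW ts)).
pose t' : {s | s \in itv p q} := exist _ t tI.
have tq : sval t' < q by apply: lt_le_trans ts sq.
rewrite (h1 t') // (h1' t') //; congr op; apply: IHn.
by apply: leq_trans rsn; rewrite -nt rank_next // (lt_ntop ts).
Qed.

Definition std_product (pq : p <= q) : X :=
  sval (std_tuple_exists pq) (exist _ q (itv_r pq)).

End StandardProduct.

Record ireduction d (E : finTBOrderType d) (p q : E) := IReduction {
  parts : {set {set {set E}}};
  phi : {Q : {set {set E}} | Q \in parts} -> {Q : {set {set E}} | Q \in parts};
  parts_partition : forall Q, Q \in parts -> itv_partition (itv p q) Q;
  parts_singletons : singletons (itv p q) \in parts;
  parts_total : [set itv p q] \in parts;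
  phi_total : phi (exist _ [set itv p q] parts_total) =
              exist _ [set itv p q] parts_total;
  phi_reduction : forall Q, sval Q != [set itv p q] ->
    is_reduction (sval Q) (sval (phi Q));
  parts_minimal : forall P : {set {set {set E}}}, P \subset parts ->
    singletons (itv p q) \in P ->
    (forall Q, sval Q \in P -> sval (phi Q) \in P) ->
    P = parts
}.
Arguments phi {d E p q i}.

Section ProductAlong.
Context {d : Order.disp_t} {E : finTBOrderType d} (p q : E) (X : Type).
Variables (op : X -> X -> X) (x : ituple p q X) (R : ireduction p q).

Notation part := {Q : {set {set E}} | Q \in parts R}.
Notation block Q := {J : {set E} | J \in sval Q}.
Notation Q0 := (exist _ (singletons (itv p q)) (parts_singletons R) : part).
Notation QT := (exist _ [set itv p q] (parts_total R) : part).

Definition family : Type := forall Q : part, block Q -> X.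

Definition is_red_family (omega : family) : Prop :=
  (forall (J : block Q0) (s : {s : E | s \in itv p q}),
     sval J = itv (sval s) (sval s) -> omega Q0 J = x s) /\
  (forall (Q : part) (J K : block Q),
     sval Q != [set itv p q] -> adjacent (sval Q) (sval J) (sval K) ->
     sval (phi Q) = merge (sval Q) (sval J) (sval K) ->
     (forall (M : block (phi Q)) (M' : block Q),
        sval M != sval J :|: sval K -> sval M = sval M' ->
        omega (phi Q) M = omega Q M') /\
     (forall M : block (phi Q), sval M = sval J :|: sval K ->
        omega (phi Q) M = op (omega Q J) (omega Q K))).

Let QP (Q : part) : itv_partition (itv p q) (sval Q).
Proof. exact: parts_partition (valP Q). Qed.

Let height (Q : part) : nat := #|sval Q0| - #|sval Q|.

Let card_phi (Q : part) : sval Q != [set itv p q] ->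
  #|sval (phi Q)|.+1 = #|sval Q|.
Proof. by case/phi_reduction=> J [K [A ->]]; apply: card_merge (QP Q) A. Qed.

Let phi_QT (Q : part) : sval Q = [set itv p q] -> phi Q = Q.
Proof. by move=> eQ; rewrite (_ : Q = QT) ?phi_total //; apply: val_inj. Qed.

Let parts_ind (P : pred part) : P Q0 -> (forall Q, P Q -> P (phi Q)) ->
  forall Q, P Q.
Proof.
move=> P0 PS; pose S : {set {set {set E}}} := [set val Q | Q in P].
have memS (Q : part) : (sval Q \in S) = P Q.
  by rewrite (mem_imset _ _ val_inj).
have SE : S = parts R.
  apply: parts_minimal => [||Q]; last by rewrite !memS; apply: PS.
    by apply/subsetP => _ /imsetP[Q _ ->]; apply: valP.
  by rewrite (memS Q0).
by move=> Q; rewrite -memS SE; apply: valP.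
Qed.

Let iter_height (Q : part) :
  (#|sval Q| <= #|sval Q0|)%N /\ iter (height Q) phi Q0 = Q.
Proof.
pose P (Q : part) := (#|sval Q| <= #|sval Q0|)%N && (iter (height Q) phi Q0 == Q).
suff /(_ Q)/andP[? /eqP] : forall Q, P Q by [].
apply: parts_ind => [|{}Q /andP[leQ /eqP iQ]].
  by rewrite /P leqnn /height subnn eqxx.
have [eQ|neQ] := eqVneq (sval Q) [set itv p q].
  by rewrite phi_QT // /P leQ iQ eqxx.
have cQ := card_phi neQ; rewrite /P -ltnS cQ leqW //=.
have -> : height (phi Q) = (height Q).+1.
  by rewrite /height -cQ subnS prednK // subn_gt0 cQ.
by rewrite iterS iQ.
Qed.

Lemma red_family_exists : p <= q -> {omega : family | is_red_family omega}.
Proof.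
move=> pq; pose p0 : {s : E | s \in itv p q} := exist _ p (itv_l pq).
pose w0 (J : {set E}) : X :=
  if [pick s : {s : E | s \in itv p q} | val s \in J] is Some s
  then x s else x p0.
pose step k (g : {set E} -> X) (M : {set E}) : X :=
  let Q := sval (iter k phi Q0) in
  if M \in Q then g M else
  if [pick JK : {set E} * {set E} |
       adjacent Q JK.1 JK.2 && (M == JK.1 :|: JK.2)] is Some JK
  then op (g JK.1) (g JK.2) else x p0.
pose w n := iteri n step w0.
exists (fun Q J => w (height Q) (sval J)); split=> [J s eJ|Q J K neQ A mQ].
  rewrite /height subnn /w /= eJ /w0; case: pickP => [s'|/(_ s)]; last first.
    by rewrite mem_itv lexx.
  by rewrite mem_itv => /le_anti es; congr x; apply: val_inj.
have [leQ iQ] := iter_height Q; have cQ := card_phi neQ.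
have -> : height (phi Q) = (height Q).+1.
  by rewrite /height -cQ subnS prednK // subn_gt0 cQ.
rewrite /w /= -/(w _) /step iQ; split=> [M M' _ ->|M ->].
  by rewrite (valP M').
rewrite (negbTE (union_notin (QP Q) A)).
case: pickP => [[J' K'] /= /andP[A' /eqP U]|/(_ (sval J, sval K)) /=].
  by have [-> ->] := adjacent_inj (QP Q) A A' U.
by rewrite A eqxx.
Qed.

Lemma red_family_unique omega omega' :
  is_red_family omega -> is_red_family omega' ->
  forall Q J, omega Q J = omega' Q J.
Proof.
move=> [h0 h1] [h0' h1'] Q; have [_ <-] := iter_height Q.
elim: (height Q) => [J|n] /=.
  have /imsetP[s sI sJ] := valP J.
  by rewrite (h0 J (exist _ s sI)) // (h0' J (exist _ s sI)).
move: (iter n phi Q0) => {}Q IH.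
have [eQ|neQ] := eqVneq (sval Q) [set itv p q]; first by rewrite phi_QT.
have [J [K [A mQ]]] := phi_reduction neQ; have /and4P[JQ KQ _ _] := A.
pose J' : block Q := exist _ J JQ; pose K' : block Q := exist _ K KQ.
have [h2 h3] := h1 Q J' K' neQ A mQ; have [h2' h3'] := h1' Q J' K' neQ A mQ.
move=> M; have [MU|MU] := eqVneq (sval M) (J :|: K).
  by rewrite h3 // h3' // !IH.
have MQ : sval M \in sval Q.
  have : sval M \in merge (sval Q) J K by rewrite -mQ; apply: valP.
  by rewrite !inE (negbTE MU) => /andP[].
pose M' : block Q := exist _ (sval M) MQ.
by rewrite (h2 M M') // (h2' M M').
Qed.

Definition red_product (pq : p <= q) : X :=
  sval (red_family_exists pq) QT (exist _ (itv p q) (set11 (itv p q))).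

End ProductAlong.

(* Main.v *)
Require Import Defs.
From HB Require Import structures.
From mathcomp Require Import all_boot all_order.

(** Let [pi] be the tuple of standard partial products, so that [pi s] is the
    product of the entries from [p] to [s] bracketed to the left.  The proof
    compares the family [omega] that defines the product along [R] with [pi]
    directly, without introducing products over subintervals: the value that
    [omega] gives to a block [[r, s]] carries the partial product just before
    [r] to the partial product at [s] by right multiplication (and is itself
    the partial product at [s] when [r = p], where nothing comes before).
    This is the predicate [carries].

    - For a singleton block it is the recursion that defines [pi].
    - If [v] does this for [[r, s]] and [w] for the adjacent [[next s, t]], and
      [a] is the partial product before [r], then the partial product at [t] is
      [op (op a v) w = op a (op v w)], so [op v w] does it for the union.  This
      is [carries_merge], the only place where associativity enters.

    Minimality of [R] says that every partition of [R] is an iterate of [phi]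
    on the partition into singletons ([parts_ind]), so all blocks of all
    partitions have the property.  For the single block [[p, q]] of the last
    partition, the case [r = p] is the theorem. *)

Set Implicit Arguments.
Unset Strict Implicit.
Unset Printing Implicit Defensive.

Import Order.Theory.

Section ProductAlongReduction.
Local Open Scope order_scope.

Lemma itv_inj d (E : finTBOrderType d) (r s r' s' : E) :
  r <= s -> r' <= s' -> itv r s = itv r' s' -> r = r' /\ s = s'.
Proof.
move=> rs rs' eI.
move: (itv_l rs) (itv_r rs) (itv_l rs') (itv_r rs'); rewrite eI -{3 4}eI.
rewrite !mem_itv => /andP[r'r _] /andP[_ ss'] /andP[rr' _] /andP[_ s's].
by split; apply/le_anti; rewrite ?r'r ?ss' ?rr' ?s's.
Qed.

Lemma itv_cat d (E : finTBOrderType d) (r s t : E) :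
  r <= s -> Defs.next s <= t -> itv r s :|: itv (Defs.next s) t = itv r t.
Proof.
move=> rs st; apply/setP => e; rewrite in_setU !mem_itv.
have [es|se] := leP e s.
  rewrite (le_trans es (le_trans (le_next s) st)) !andbT; apply: orb_idr.
  exact: le_trans (le_trans rs (le_next s)).
by rewrite andbF (next_min se) (le_trans rs (ltW se)).
Qed.

(** The two blocks are disjoint, which excludes the fixed point
    [next \top = \top] and makes the successor strict. *)
Lemma adjacentP d (E : finTBOrderType d) (I : {set E}) Q J K :
  itv_partition I Q -> adjacent Q J K ->
  exists r s t, [/\ r <= s, s < Defs.next s, Defs.next s <= t,
                    J = itv r s & K = itv (Defs.next s) t].
Proof.
move=> Qp /and4P[JQ KQ nJK] /existsP[r /existsP[s /existsP[u /existsP[t]]]].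
case/and5P=> rs ut /eqP eJ /eqP eK /eqP su; subst u; exists r, s, t; split=> //.
rewrite lt_neqAle le_next andbT; apply: contraNneq nJK => su; apply/eqP.
by apply: (block_eq Qp JQ KQ (e := s)); rewrite ?eJ ?eK ?itv_r // {1}su itv_l.
Qed.

Variables (d : Order.disp_t) (E : finTBOrderType d) (p q : E).
Variables (X : Type) (op : X -> X -> X) (x : ituple p q X).

Section Carries.
Variable pi : ituple p q X.

(** Two clauses because [X] has no unit to serve as the empty product when
    [r = p]. *)
Definition carries (J : {set E}) (v : X) : Prop :=
  forall r s : {e : E | e \in itv p q}, sval r <= sval s ->
  J = itv (sval r) (sval s) ->
  (sval r = p -> pi s = v) /\
  (forall t : {e : E | e \in itv p q}, sval t < sval r ->
     Defs.next (sval t) = sval r -> pi s = op (pi t) v).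

Lemma carries_singleton (s : {e : E | e \in itv p q}) :
  is_std_tuple op x pi -> carries (itv (sval s) (sval s)) (x s).
Proof.
move=> [pi0 piS] r s' rs' /itv_inj[] // sr /val_inj ss'; subst s'.
split=> [rp|t tr nt]; first by rewrite pi0 // sr.
apply: piS; last by rewrite nt.
by apply: lt_le_trans tr _; have := valP r; rewrite mem_itv => /andP[].
Qed.

Lemma carries_merge (opA : associative op) Q J K v w :
  itv_partition (itv p q) Q -> adjacent Q J K ->
  carries J v -> carries K w -> carries (J :|: K) (op v w).
Proof.
move=> Qp A cJ cK; have /and4P[JQ KQ _ _] := A.
have [r0 [s [t0 [rs ss st eJ eK]]]] := adjacentP Qp A.
have inI L e : L \in Q -> e \in L -> e \in itv p q.
  by move=> LQ; apply/subsetP; have [] := Qp.1 _ LQ.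
have sI : s \in itv p q by apply: (inI J); rewrite // eJ itv_r.
have uI : Defs.next s \in itv p q by apply: (inI K); rewrite // eK itv_l.
move=> r t rt; rewrite eJ eK itv_cat // => /itv_inj[|//|er et].
  exact: le_trans rs (le_trans (ltW ss) st).
subst r0 t0; pose s' : {e : E | e \in itv p q} := exist _ s sI.
have [_ /(_ s') piK] := cK (exist _ (Defs.next s) uI) t st eK.
have [piJ0 piJ] := cJ r s' rs eJ.
rewrite piK //; split=> [/piJ0->//|a ar na].
by rewrite (piJ a) // opA.
Qed.

End Carries.

Variable R : ireduction p q.

Notation part := {Q : {set {set E}} | Q \in parts R}.
Notation Q0 := (exist _ (singletons (itv p q)) (parts_singletons R) : part).
Notation QT := (exist _ [set itv p q] (parts_total R) : part).

(** Minimality speaks of finite sets, hence of boolean properties only.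
    Applying it to the orbit of [Q0] under [phi] shows that this orbit is
    everything, and then [P] propagates along the iterates of [phi]. *)
Lemma parts_ind (P : part -> Prop) :
  P Q0 -> (forall Q, P Q -> P (phi Q)) -> forall Q, P Q.
Proof.
move=> P0 PS Q.
pose S : {set {set {set E}}} := [set val Q' | Q' in fconnect phi Q0].
have memS (Q' : part) : (sval Q' \in S) = fconnect phi Q0 Q'.
  by rewrite (mem_imset _ _ val_inj).
have SE : S = parts R.
  apply: parts_minimal => [||Q'].
  - by apply/subsetP => _ /imsetP[Q' _ ->]; apply: valP.
  - by rewrite (memS Q0) connect0.
  - by rewrite !memS => /connect_trans; apply; apply: fconnect1.
have /iter_findex <- : fconnect phi Q0 Q by rewrite -memS SE; apply: valP.
by elim: (findex _ _ _) => //= n; apply: PS.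
Qed.

Lemma red_family_carries (opA : associative op) (pi : ituple p q X)
    (omega : Defs.family X R) :
  is_std_tuple op x pi -> is_red_family op x omega ->
  forall Q J, carries pi (sval J) (omega Q J).
Proof.
move=> piP [om0 omS]; elim/parts_ind=> [J|Q IH].
  have /imsetP[s sI eJ] := valP J.
  pose s' : {e : E | e \in itv p q} := exist _ s sI.
  by rewrite (om0 J s') // eJ; apply: (carries_singleton (s := s')).
have [eQ|neQ] := eqVneq (sval Q) [set itv p q].
  have <- // : Q = phi Q.
  by rewrite (_ : Q = QT) ?phi_total //; apply: val_inj.
have [J [K [A mQ]]] := phi_reduction neQ; have /and4P[JQ KQ _ _] := A.
have [omM omU] := omS Q (exist _ J JQ) (exist _ K KQ) neQ A mQ.
move=> M; have [MU|MU] := eqVneq (sval M) (J :|: K).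
  rewrite omU // MU.
  apply: (carries_merge opA (parts_partition (valP Q)) A);
    [exact: (IH (exist _ J JQ)) | exact: (IH (exist _ K KQ))].
have MQ : sval M \in sval Q.
  have : sval M \in Defs.merge (sval Q) J K by rewrite -mQ; apply: valP.
  by rewrite !inE (negbTE MU) => /andP[].
by rewrite (omM M (exist _ (sval M) MQ)) //; apply: (IH (exist _ (sval M) MQ)).
Qed.

End ProductAlongReduction.

Theorem theorem12p2 (d : Order.disp_t) (E : finTBOrderType d) (p q : E)
    (pq : (p <= q)%O) (X : Type) (X0 : inhabited X) (op : X -> X -> X)
    (opA : associative op) (x : ituple p q X) (R : ireduction p q) :
  red_product op x R pq = std_product op x pq.
Proof.
rewrite /red_product /std_product.
case: std_tuple_exists => pi piP; case: red_family_exists => omega omegaP /=.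
have tot := red_family_carries opA piP omegaP.
have /(_ (exist _ p (itv_l pq)) (exist _ q (itv_r pq)) pq erefl)[piq _] :=
  tot (exist _ [set itv p q] (parts_total R))
      (exist _ (itv p q) (set11 (itv p q))).
by rewrite piq.
Qed.
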